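(* Let $s,t,\alpha_1,\ldots,\alpha_s,\beta_1,\ldots,\beta_t$ be positive integers and let $1\le k_1<\cdots<k_s$ and $1\le \ell_1<\cdots<\ell_t$ be integers such that, up to isomorphism of directed graphs, $$\bigotimes_{i=1}^s\left(C_1+\alpha_iC_{k_i}\right)=\bigotimes_{j=1}^t\left(C_1+\beta_jC_{\ell_j}\right).$$ Then $s=t$, and $k_i=\ell_i$ and $\alpha_i=\beta_i$ for all $1\le i\le s$.
   Context: $C_m$ denotes the directed cycle of length $m$ ($C_1$ is a single vertex with a loop). For directed graphs, $G+H$ denotes disjoint union and $mG$ the disjoint union of $m$ copies of $G$. The tensor product $G_1\otimes G_2$ of directed graphs is the directed graph with vertex set $V(G_1)\times V(G_2)$ in which $(v_1,v_2)\to(w_1,w_2)$ is an edge if and only if $v_i\to w_i$ is an edge of $G_i$ for $i=1,2$. *)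

(* Defs.v *)
From mathcomp Require Import all_boot.

Set Implicit Arguments.
Unset Strict Implicit.
Unset Printing Implicit Defensive.

(* Loops are allowed, multiple edges are not. *)
Record digraph := Digraph { vertex :> finType; edge : rel vertex }.

Definition digraph_iso (G H : digraph) : Prop :=
  exists f : G -> H,
    bijective f /\ forall x y : G, edge (f x) (f y) = edge x y.

(* [ordS i] is i + 1 modulo m, so [dicycle 1] is a single vertex with a loop;
   [dicycle 0] is the empty digraph. *)
Definition dicycle (m : nat) : digraph :=
  Digraph (fun i j : 'I_m => j == ordS i).

Definition disjoint_union (G H : digraph) : digraph :=
  @Digraph (G + H)%type (fun x y =>
    match x, y with
    | inl u, inl v => edge u v
    | inr u, inr v => edge u v
    | _, _ => false
    end).

Definition copies (m : nat) (G : digraph) : digraph :=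
  @Digraph ('I_m * G)%type
    (fun x y => (x.1 == y.1) && edge x.2 y.2).

Definition tensor (G H : digraph) : digraph :=
  @Digraph (G * H)%type
    (fun x y => edge x.1 y.1 && edge x.2 y.2).

(* The iterated product ends with a factor C_1, which is neutral for the tensor
   product up to isomorphism (see [tensor_dicycle1]). *)
Definition big_tensor (s : nat) (G : 'I_s -> digraph) : digraph :=
  \big[tensor/dicycle 1]_(i < s) G i.

Lemma tensor_dicycle1 (G : digraph) : digraph_iso (tensor G (dicycle 1)) G.
Proof.
exists fst; split.
  exists (fun x => (x, ord0)) => [[x i]|] //=.
  by rewrite [i]ord1.
move=> [x i] [y j] /=.
have -> : (j == ordS i) by rewrite [j]ord1 [ordS i]ord1.
by rewrite andbT.
Qed.

(* Main.v *)
(** Closed walks of length [n] are counted multiplicatively by [tensor] and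
    additively by [disjoint_union], and [dicycle m] has [m] of them if [m]
    divides [n] and none otherwise.  Hence, for every [n > 0], the product of
    [1 + alpha i * k i] over the [i] with [k i %| n] is an isomorphism
    invariant.  Cancelling the proper divisors of [n], by strong induction, the
    product over the [i] with [k i = n] is also an invariant; it has at most one
    factor, and this factor exceeds 1, so it determines [k] and [alpha]. *)

Require Import Defs.
From mathcomp Require Import all_boot.

Set Implicit Arguments.
Unset Strict Implicit.
Unset Printing Implicit Defensive.

Fixpoint walk (G : digraph) (n : nat) (x y : G) : bool :=
  if n is n'.+1 then [exists z, edge x z && walk n' z y] else x == y.

(** Counts base points rather than walks. The two counts agree when every vertex has exactly one
    out-neighbour, as in products and disjoint unions of cycles. *)
Definition closed_walks (G : digraph) (n : nat) : nat :=
  #|[pred x : G | walk n x x]|.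

Lemma closed_walks_iso (G H : digraph) (n : nat) :
  digraph_iso G H -> closed_walks G n = closed_walks H n.
Proof.
case=> f [bij_f edge_f]; have [g fK gK] := bij_f.
have walk_f m x y : walk m (f x) (f y) = walk m x y.
  elim: m x => [|m IHm] x /=; first by rewrite (inj_eq (bij_inj bij_f)).
  apply/existsP/existsP => -[z /andP[xz zy]].
    by exists (g z); rewrite -edge_f -IHm gK xz.
  by exists (f z); rewrite edge_f IHm xz.
rewrite /closed_walks -(card_image (bij_inj bij_f)); apply: eq_card => y.
by rewrite -[y]gK (mem_image (bij_inj bij_f)) !inE walk_f.
Qed.

Lemma closed_walks_tensor (G H : digraph) (n : nat) :
  closed_walks (tensor G H) n = closed_walks G n * closed_walks H n.
Proof.
have walkE m (x y : tensor G H) :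
    walk m x y = walk m x.1 y.1 && walk m x.2 y.2.
  elim: m x => [|m IHm] x //=.
  apply/existsP/andP => [[z]|[/existsP[u /andP[xu uy]] /existsP[v /andP[xv vy]]]].
    rewrite IHm => /andP[/andP[x1 x2] /andP[y1 y2]].
    by split; apply/existsP; [exists z.1 | exists z.2]; apply/andP.
  by exists (u, v); rewrite IHm /= xu xv uy vy.
rewrite /closed_walks -cardX; apply: eq_card => x.
by rewrite !inE walkE.
Qed.

Lemma closed_walks_disjoint_union (G H : digraph) (n : nat) :
  closed_walks (disjoint_union G H) n = closed_walks G n + closed_walks H n.
Proof.
have walk_inl m x y : walk m (inl x : disjoint_union G H) (inl y) = walk m x y.
  elim: m x => [|m IHm] x //=.
  apply/existsP/existsP => [[[z|z] //=]|[z]]; rewrite -?IHm.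
    by exists z; rewrite -IHm.
  by exists (inl z).
have walk_inr m x y : walk m (inr x : disjoint_union G H) (inr y) = walk m x y.
  elim: m x => [|m IHm] x //=.
  apply/existsP/existsP => [[[z|z] //=]|[z]]; rewrite -?IHm.
    by exists z; rewrite -IHm.
  by exists (inr z).
rewrite /closed_walks -!sum1_card big_sumType /=.
by congr (_ + _); apply: eq_bigl => x; rewrite !inE ?walk_inl ?walk_inr.
Qed.

Lemma closed_walks_copies (m : nat) (G : digraph) (n : nat) :
  closed_walks (copies m G) n = m * closed_walks G n.
Proof.
have walkE p (x y : copies m G) :
    walk p x y = (x.1 == y.1) && walk p x.2 y.2.
  elim: p x => [|p IHp] x //=.
  apply/existsP/andP => [[z]|[/eqP xy1 /existsP[v /andP[xv vy]]]].
    rewrite IHp => /andP[/andP[/eqP-> x2] /andP[y1 y2]].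
    by split=> //; apply/existsP; exists z.2; rewrite x2.
  by exists (y.1, v); rewrite IHp /= xy1 eqxx xv.
rewrite /closed_walks -[m in RHS]card_ord -cardX; apply: eq_card => x.
by rewrite !inE walkE eqxx.
Qed.

(** The only walk of length [n] from [x] ends at [x + n] modulo [m], so either every vertex is a
    base point or none is. *)
Lemma closed_walks_dicycle (m n : nat) :
  closed_walks (dicycle m) n = if m %| n then m else 0.
Proof.
have walkE p (x y : 'I_m) :
    walk p (x : dicycle m) y = (y == (x + p) %% m :> nat).
  elim: p x => [|p IHp] x /=; first by rewrite addn0 modn_small // eq_sym.
  have -> : (x + p.+1) %% m = (ordS x + p) %% m.
    by rewrite /= modnDml addSnnS.
  rewrite -IHp; apply/existsP/idP => [[z /andP[/eqP-> //]]|xy].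
  by exists (ordS x); rewrite eqxx.
have fixE (x : 'I_m) : (x == (x + n) %% m :> nat) = (m %| n).
  rewrite -{1}[x : nat](modn_small (ltn_ord x)) -{1}[x : nat]addn0 eqn_modDl.
  by rewrite mod0n eq_sym.
rewrite /closed_walks -sum1_card.
under eq_bigl => x do rewrite inE walkE fixE.
by case: ifP => _; rewrite ?big_pred0_eq // sum1_card card_ord.
Qed.

Lemma closed_walks_big_tensor (s : nat) (G : 'I_s -> digraph) (n : nat) :
  closed_walks (big_tensor G) n = \prod_(i < s) closed_walks (G i) n.
Proof.
rewrite /big_tensor.
elim/big_rec2: _ => [|i p H _ <-]; last exact: closed_walks_tensor.
by rewrite closed_walks_dicycle dvd1n.
Qed.

(** A factor whose [k i] does not divide [n] has only the loop of [dicycle 1] to offer; it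
    contributes 1 and drops out of the product. *)
Lemma closed_walks_factors (s : nat) (alpha k : 'I_s -> nat) (n : nat) :
  closed_walks (big_tensor (fun i : 'I_s =>
    disjoint_union (dicycle 1) (copies (alpha i) (dicycle (k i))))) n
  = \prod_(i < s | k i %| n) (1 + alpha i * k i).
Proof.
rewrite closed_walks_big_tensor [RHS]big_mkcond; apply: eq_bigr => i _.
rewrite closed_walks_disjoint_union closed_walks_copies !closed_walks_dicycle.
by rewrite dvd1n; case: ifP => _; rewrite ?muln0.
Qed.

Lemma prod_dvdn_fibers (I : finType) (k a : I -> nat) (n : nat) : 0 < n ->
  \prod_(i | k i %| n) a i
  = \prod_(d < n.+1 | d %| n) \prod_(i | k i == d) a i.
Proof.
move=> n_gt0.
(* [inord] is faithful here: a divisor of a positive [n] is at most [n]. *)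
rewrite (partition_big (fun i => inord (k i)) (fun d : 'I_n.+1 => d %| n)) /=.
  apply: eq_bigr => d d_n; apply: eq_bigl => i.
  apply/andP/eqP => [[k_n /eqP<-]|k_d].
    by rewrite inordK // ltnS dvdn_leq.
  by rewrite k_d inord_val.
by move=> i k_n; rewrite inordK // ltnS dvdn_leq.
Qed.

Lemma prod_dvdn_inj (I J : finType) (k a : I -> nat) (l b : J -> nat) :
    (forall i, 0 < a i) -> (forall j, 0 < b j) ->
    (forall n, 0 < n -> \prod_(i | k i %| n) a i = \prod_(j | l j %| n) b j) ->
  forall n, 0 < n -> \prod_(i | k i == n) a i = \prod_(j | l j == n) b j.
Proof.
move=> a_gt0 b_gt0 eq_ab n; have [m] := ubnP n; elim: m n => // m IHm n.
rewrite ltnS => n_m n_gt0.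
have := eq_ab n n_gt0.
rewrite (prod_dvdn_fibers k) // (prod_dvdn_fibers l) //.
(* [ord_max] is the divisor [n] itself. The other indices are the proper divisors, where the
   induction hypothesis applies; their common product is positive and cancels. *)
rewrite (bigD1 ord_max) //= [in RHS](bigD1 ord_max) //=.
have -> : \prod_(d < n.+1 | (d %| n) && (d != ord_max))
            \prod_(i | k i == d) a i
        = \prod_(d < n.+1 | (d %| n) && (d != ord_max))
            \prod_(j | l j == d) b j.
  apply: eq_bigr => d /andP[d_n d_max]; apply: IHm; last exact: dvdn_gt0 d_n.
  by apply: leq_trans n_m; rewrite ltn_neqAle -ltnS ltn_ord andbT.
move/eqP; rewrite eqn_pmul2r => [/eqP//|].
by apply: prodn_gt0 => d; apply: prodn_gt0.
Qed.

Lemma sorted_codom_ord (s : nat) (k : 'I_s -> nat) :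
  (forall i i' : 'I_s, i < i' -> k i < k i') -> sorted ltn (codom k).
Proof.
move=> k_incr; rewrite codomE.
apply: (homo_sorted (e := relpre val ltn)) => //.
by rewrite -sorted_map val_enum_ord iota_ltn_sorted.
Qed.

Lemma codom_ord_inj (s t : nat) (k : 'I_s -> nat) (l : 'I_t -> nat) :
  codom k = codom l -> exists e : s = t, forall i, k i = l (cast_ord e i).
Proof.
move=> eq_kl; have e : s = t.
  by have := congr1 size eq_kl; rewrite !size_codom !card_ord.
(* Once [t] is replaced by [s], the cast is the identity and the two lists can be compared entry by
   entry. *)
exists e; case: t / e l eq_kl => l eq_kl i; rewrite cast_ord_id.
have nth_i (h : 'I_s -> nat) : nth 0 (codom h) i = h i.
  by have := nth_codom 0 h (enum_rank i); rewrite enum_rankK enum_rank_ord.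
by rewrite -(nth_i k) eq_kl nth_i.
Qed.

Lemma prod_fiber_inj (I : finType) (k a : I -> nat) (i : I) :
  injective k -> \prod_(i' | k i' == k i) a i' = a i.
Proof.
by move=> inj_k; rewrite (eq_bigl (pred1 i)) ?big_pred1_eq // => i'; exact: inj_eq.
Qed.

(** An empty fiber gives the empty product 1, while a nonempty one is a single point whose factor
    exceeds 1. *)
Lemma mem_codom_prod_fiber (I : finType) (k a : I -> nat) (n : nat) :
    injective k -> (forall i, 1 < a i) ->
  (n \in codom k) = (1 < \prod_(i | k i == n) a i).
Proof.
move=> inj_k a_gt1; apply/codomP/idP => [[i ->]|]; first by rewrite prod_fiber_inj.
case: (pickP (fun i => k i == n)) => [i /eqP<- _|no_i]; first by exists i.
by rewrite big_pred0.
Qed.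

Theorem theorem3 (s t : nat)
    (alpha k : 'I_s -> nat) (beta l : 'I_t -> nat)
    (s_gt0 : 0 < s) (t_gt0 : 0 < t)
    (alpha_gt0 : forall i, 0 < alpha i) (beta_gt0 : forall j, 0 < beta j)
    (k_gt0 : forall i, 1 <= k i) (l_gt0 : forall j, 1 <= l j)
    (k_incr : forall i i' : 'I_s, i < i' -> k i < k i')
    (l_incr : forall j j' : 'I_t, j < j' -> l j < l j')
    (iso_kl : digraph_iso
      (big_tensor (fun i : 'I_s =>
        disjoint_union (dicycle 1) (copies (alpha i) (dicycle (k i)))))
      (big_tensor (fun j : 'I_t =>
        disjoint_union (dicycle 1) (copies (beta j) (dicycle (l j)))))) :
  exists e : s = t, forall i : 'I_s,
    k i = l (cast_ord e i) /\ alpha i = beta (cast_ord e i).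
Proof.
have inj_incr r (h : 'I_r -> nat) :
    (forall i i' : 'I_r, i < i' -> h i < h i') -> injective h.
  move=> h_incr i i' eq_h; apply: val_inj.
  by case: (ltngtP i i') => // /h_incr; rewrite eq_h ltnn.
have inj_k := inj_incr s k k_incr; have inj_l := inj_incr t l l_incr.
have eq_prod n : 0 < n -> \prod_(i | k i == n) (1 + alpha i * k i)
                        = \prod_(j | l j == n) (1 + beta j * l j).
  apply: prod_dvdn_inj n => // n _.
  by rewrite -!closed_walks_factors; apply: closed_walks_iso.
have eq_codom : codom k = codom l.
  (* A strictly increasing list is determined by its set of entries, so only membership remains to
     be compared. The value 0, out of reach of [eq_prod], is attained on neither side. *)
  apply: (irr_sorted_eq ltn_trans ltnn); try exact: sorted_codom_ord.
  case=> [|n].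
    by apply/codomP/codomP => -[i n_i]; [have := k_gt0 i | have := l_gt0 i];
      rewrite -n_i.
  rewrite (@mem_codom_prod_fiber _ k (fun i => 1 + alpha i * k i)) //; last first.
    by move=> i; rewrite ltnS muln_gt0 alpha_gt0 k_gt0.
  rewrite (@mem_codom_prod_fiber _ l (fun j => 1 + beta j * l j)) ?eq_prod //.
  by move=> j; rewrite ltnS muln_gt0 beta_gt0 l_gt0.
have [e k_l] := codom_ord_inj eq_codom; exists e => i; split=> //.
(* At [n = k i] each fiber is a single point, leaving two factors 1 + multiplicity * length with the
   same positive length, which cancels. *)
have := eq_prod (k i) (k_gt0 i).
rewrite prod_fiber_inj // k_l prod_fiber_inj // => -[] /eqP.
by rewrite eqn_pmul2r // => /eqP.
Qed.
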